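(* Let $d,m,n,q$ be positive integers with $d\ll m\ll n$, let $c_z>0$, let $\bm{Z}=[\bm{z}_1,\ldots,\bm{z}_n]\in\mathbb{R}^{d\times n}$ be full-rank with $\Vert\bm{Z}\Vert_\infty\leq c_z$, let $f:\mathbb{R}^d\to\mathbb{R}^m$ be analytic, and let $\bm{X}=[\bm{x}_1,\ldots,\bm{x}_n]\in\mathbb{R}^{m\times n}$ with $\bm{x}_j=f(\bm{z}_j)$ for $j=1,\ldots,n$. Let $\phi:\mathbb{R}^m\to\mathbb{R}^l$ be a $q$-order polynomial feature map (with $l=\binom{m+q}{q}$) and $\phi(\bm{X})=[\phi(\bm{x}_1),\ldots,\phi(\bm{x}_n)]\in\mathbb{R}^{l\times n}$. Then for any positive integer $q'$ obeying $\binom{d+q'}{q'}\leq\min\{l,n\}$, there exists a matrix $\bm{\Phi}\in\mathbb{R}^{l\times n}$ with $\textup{rank}(\bm{\Phi})\leq\binom{d+q'}{q'}$ such that $$\Vert\phi(\bm{X})-\bm{\Phi}\Vert_\infty\leq c_{q'},\qquad c_{q'}=\frac{c_z^{q'+1}}{(q'+1)!}\max_{\Vert\bm{z}\Vert_\infty\leq c_z}\Vert(\phi\circ f)^{(q'+1)}(\bm{z})\Vert_\infty .$$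
   Context: For a matrix $\bm{Y}$, $\Vert\bm{Y}\Vert_\infty=\max_{ij}|Y_{ij}|$. A $q$-order polynomial feature map of $\bm{x}\in\mathbb{R}^m$ is $\phi(\bm{x})=(c_\mu x_1^{\mu_1}x_2^{\mu_2}\cdots x_m^{\mu_m})_{|\mu|\leq q}\in\mathbb{R}^l$, where $\mu=(\mu_1,\ldots,\mu_m)$ ranges over all multi-indices of non-negative integers with $|\mu|=\mu_1+\cdots+\mu_m\leq q$, the parameters $c_\mu$ are nonzero real numbers, and $l=\binom{m+q}{q}$. For a smooth map $g:\mathbb{R}^d\to\mathbb{R}^l$, $g^{(k)}$ denotes its $k$-th order derivative and $\Vert g^{(k)}(\bm{z})\Vert_\infty$ denotes $\max_{i}\sup_{\Vert\bm{h}\Vert_\infty\leq 1}|D^kg_i(\bm{z})[\bm{h},\ldots,\bm{h}]|$, the largest (over output coordinates $g_i$) $\ell_\infty$-size of the $k$-th derivative. *)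

(* Defs.v *)
From HB Require Import structures.
From mathcomp Require Import all_boot all_order all_algebra.
From mathcomp Require Import all_classical all_reals all_analysis.
Set Implicit Arguments. Unset Strict Implicit. Unset Printing Implicit Defensive.
Import Order.TTheory GRing.Theory Num.Theory.
Import numFieldNormedType.Exports.
Local Open Scope ring_scope.
Local Open Scope classical_set_scope.

Definition monom (R : realType) (d : nat) (mu : {ffun 'I_d -> nat})
  (x : 'cV[R]_d) : R := \prod_(i < d) (x i 0) ^+ (mu i).

Definition box_mi (d N : nat) (b : {ffun 'I_d -> 'I_N.+1}) : {ffun 'I_d -> nat} :=
  [ffun i => nat_of_ord (b i)].

Definition psum (R : realType) (d : nat) (a : {ffun 'I_d -> nat} -> R)
  (x0 x : 'cV[R]_d) (N : nat) : R :=
  \sum_(b : {ffun 'I_d -> 'I_N.+1}) a (box_mi b) * monom (box_mi b) (x - x0).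

Definition psum_abs (R : realType) (d : nat) (a : {ffun 'I_d -> nat} -> R)
  (x0 x : 'cV[R]_d) (N : nat) : R :=
  \sum_(b : {ffun 'I_d -> 'I_N.+1}) `|a (box_mi b)| * `|monom (box_mi b) (x - x0)|.

Definition analytic_at (R : realType) (d : nat) (F : 'cV[R]_d -> R) (x0 : 'cV[R]_d) :=
  exists a : {ffun 'I_d -> nat} -> R, exists r : R, 0 < r /\
    forall x : 'cV[R]_d, (forall i, `|x i 0 - x0 i 0| < r) ->
      cvgn (psum_abs a x0 x) /\ (psum a x0 x @ \oo --> F x).

Definition analytic (R : realType) (d m : nat) (f : 'cV[R]_d -> 'cV[R]_m) :=
  forall (k : 'I_m) (x0 : 'cV[R]_d), analytic_at (fun z => f z k 0) x0.

(* k-th derivative evaluated on the diagonal: D^k F(z)[h,...,h],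
   as the iterated directional derivative along h *)
Definition Dk (R : realType) (d : nat) (k : nat) (F : 'cV[R]_d -> R)
  (z h : 'cV[R]_d) : R :=
  iter k (fun G : 'cV[R]_d -> R => fun y => derive G y h) F z.

Definition poly_feature_data (m q : nat) (R : realType)
  (e : 'I_('C(m + q, q)) -> {ffun 'I_m -> nat}) (cf : 'I_('C(m + q, q)) -> R) :=
  [/\ injective e,
      (forall k, (\sum_(i < m) e k i <= q)%N),
      (forall mu : {ffun 'I_m -> nat}, (\sum_(i < m) mu i <= q)%N -> exists k, e k = mu)
    & (forall k, cf k != 0)].

Definition feat (m q : nat) (R : realType)
  (e : 'I_('C(m + q, q)) -> {ffun 'I_m -> nat}) (cf : 'I_('C(m + q, q)) -> R)
  (x : 'cV[R]_m) : 'cV[R]_('C(m + q, q)) :=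
  \col_k (cf k * monom (e k) x).

(* the set of values |D^k g_i(z)[h,...,h]| over output coordinates i,
   points z with ||z||_inf <= c and directions h with ||h||_inf <= 1;
   its sup is max_{||z||_inf<=c} ||g^(k)(z)||_inf *)
Definition deriv_vals (R : realType) (d l k : nat) (g : 'cV[R]_d -> 'cV[R]_l)
  (c : R) : set R :=
  [set r | exists (i : 'I_l) (z h : 'cV[R]_d),
     [/\ (forall a, `|z a 0| <= c), (forall a, `|h a 0| <= 1)
       & r = `|Dk k (fun y => g y i 0) z h|]].

(* Main.v *)
(** Restricted to a line, an analytic function is a power series
    [F (x0 + y + t h) = sum_k c_k t^k]: each monomial [(y + t h)^mu] is a
    polynomial in [t] majorized coefficientwise by
    [prod_i (|y_i| + |h_i| t)^mu_i], so absolute convergence allows regrouping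
    by powers of [t].  It also gives [|c_k| tau^k <= M] with [M] uniform in
    [y] and [h]; since [D^k F (x0 + y)[h,...,h] = k! c_k], the diagonal
    derivatives are locally bounded, and at the origin they are homogeneous
    polynomials of degree [k] in [h].  Both properties pass to products, hence
    to the polynomial features of [f].  By compactness the supremum in the
    error term is finite, and Taylor's formula along the segment from [0] to
    [z_j] approximates the features by combinations of the [C(d + q', q')]
    monomials of degree at most [q'] in [z_j]. *)

Require Import Defs.
From HB Require Import structures.
From mathcomp Require Import all_boot all_order all_algebra.
From mathcomp Require Import all_classical all_reals all_analysis.
From mathcomp Require Import zify lra ring.
Import Order.TTheory GRing.Theory Num.Theory.
Import numFieldNormedType.Exports.
Local Open Scope ring_scope.
Local Open Scope classical_set_scope.
Set Implicit Arguments. Unset Strict Implicit. Unset Printing Implicit Defensive.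

(** * Sums over multi-indices *)

(** Partial sums over cubes: [psum] and [psum_abs] both have this form, so one convergence theory
    serves them. *)
Definition box_sum (R : realType) (d : nat) (f : {ffun 'I_d -> nat} -> R)
  (N : nat) : R := \sum_(b : {ffun 'I_d -> 'I_N.+1}) f (box_mi b).

(** Brings sums over different cubes into one index type, where they can be subtracted term by
    term. *)
Lemma box_sum_widen (R : realType) (d : nat) (f : {ffun 'I_d -> nat} -> R)
  (N N' : nat) : (N <= N')%N ->
  box_sum f N =
  \sum_(b : {ffun 'I_d -> 'I_N'.+1} | [forall i, b i <= N]%N) f (box_mi b).
Proof.
move=> NN'; have NN1 : (N.+1 <= N'.+1)%N by [].
rewrite (reindex_onto (fun b : {ffun 'I_d -> 'I_N.+1} =>
    [ffun i => widen_ord NN1 (b i)] : {ffun 'I_d -> 'I_N'.+1})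
  (fun b => [ffun i => inord (b i)])) /=; last first.
  move=> b /forallP bN; apply/ffunP => i; rewrite !ffunE; apply/val_inj => /=.
  by rewrite inordK// ltnS bN.
apply: eq_big => [b|b _]; last first.
  by congr f; apply/ffunP => i; rewrite !ffunE.
symmetry; apply/andP; split.
  by apply/forallP => i; rewrite ffunE /= -ltnS.
by apply/eqP/ffunP => i; rewrite !ffunE; apply/val_inj; rewrite /= inordK.
Qed.

Section BoxSum.
Variables (R : realType) (d : nat).
Implicit Types f g : {ffun 'I_d -> nat} -> R.

Lemma box_sumD f g N :
  box_sum (fun mu => f mu + g mu) N = box_sum f N + box_sum g N.
Proof. exact: big_split. Qed.

Lemma ler_box_sum f g N :
  (forall mu, f mu <= g mu) -> box_sum f N <= box_sum g N.
Proof. by move=> fg; apply: ler_sum. Qed.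

(** Only the indices of the larger cube outside the smaller one survive in either difference. *)
Lemma ler_norm_box_sumB f g N N' : (forall mu, `|f mu| <= g mu) ->
  (N <= N')%N ->
  `|box_sum f N' - box_sum f N| <= box_sum g N' - box_sum g N.
Proof.
move=> fg NN'; rewrite !(box_sum_widen _ NN').
rewrite [X in `|X - _|](bigID (fun b : {ffun 'I_d -> 'I_N'.+1} =>
  [forall i, b i <= N]%N)) /= addrAC subrr add0r.
rewrite [X in _ <= X - _](bigID (fun b : {ffun 'I_d -> 'I_N'.+1} =>
  [forall i, b i <= N]%N)) /= addrAC subrr add0r.
by apply: (le_trans (ler_norm_sum _ _ _)); apply: ler_sum.
Qed.

Lemma nondecreasing_box_sum f : (forall mu, 0 <= f mu) ->
  nondecreasing_seq (box_sum f).
Proof.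
move=> f0; apply/nondecreasing_seqP => N; rewrite -subr_ge0.
apply: le_trans (@ler_norm_box_sumB f f _ _ _ (leqnSn N)); first by [].
by move=> mu; rewrite ger0_norm.
Qed.

(** The series of [f + g] has nonnegative terms and partial sums at most twice the limit for [g], so
    it converges by monotonicity; subtracting [g] leaves [f]. *)
Lemma cvg_box_sum_dominated f g : (forall mu, `|f mu| <= g mu) ->
  cvgn (box_sum g) -> cvgn (box_sum f).
Proof.
move=> fg cg.
have g0 mu : 0 <= g mu by apply: le_trans (fg mu).
have -> : box_sum f =
    box_sum (fun mu => f mu + g mu) \- box_sum g.
  by apply/funext => N; rewrite /= box_sumD addrK.
apply: is_cvgB => //; apply: nondecreasing_is_cvgn.
  by apply: nondecreasing_box_sum => mu; have := fg mu; rewrite ler_norml; lra.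
exists (limn (box_sum g) + limn (box_sum g)) => _ [N _ <-].
rewrite box_sumD.
have SgN : box_sum g N <= limn (box_sum g).
  by apply: nondecreasing_cvgn_le => //; exact: nondecreasing_box_sum.
apply: lerD => //; apply: le_trans SgN; apply: ler_box_sum => mu.
by have := fg mu; rewrite ler_norml => /andP[].
Qed.

Lemma ler_box_sum_lim f N : (forall mu, 0 <= f mu) -> cvgn (box_sum f) ->
  box_sum f N <= limn (box_sum f).
Proof.
by move=> f0 cf; apply: nondecreasing_cvgn_le => //; exact: nondecreasing_box_sum.
Qed.

Lemma ler_norm_box_sum_tail f g N : (forall mu, `|f mu| <= g mu) ->
  cvgn (box_sum g) ->
  `|limn (box_sum f) - box_sum f N| <= limn (box_sum g) - box_sum g N.
Proof.
move=> fg cg; have cf := cvg_box_sum_dominated fg cg.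
apply: (@ler_cvg_to nat \oo _ R (fun n => `|box_sum f n - box_sum f N|)
  (fun n => box_sum g n - box_sum g N)).
- by apply: cvg_norm; apply: cvgB => //; exact: cvg_cst.
- by apply: cvgB => //; exact: cvg_cst.
- by exists N => // n /= Nn; exact: ler_norm_box_sumB.
Qed.

Lemma ler_norm_box_sum_lim f g : (forall mu, `|f mu| <= g mu) ->
  cvgn (box_sum g) -> `|limn (box_sum f)| <= limn (box_sum g).
Proof.
move=> fg cg; have cf := cvg_box_sum_dominated fg cg.
apply: (@ler_cvg_to nat \oo _ R (fun n => `|box_sum f n|) (box_sum g)) => //.
- exact: cvg_norm.
- exists 0%N => // n _; apply: le_trans (ler_norm_sum _ _ _) _.
  exact: ler_sum.
Qed.

Lemma box_sum_stable f N N' :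
  (forall mu : {ffun 'I_d -> nat}, ~~ [forall i, mu i <= N]%N -> f mu = 0) ->
  (N <= N')%N -> box_sum f N' = box_sum f N.
Proof.
move=> f0 NN'; rewrite (box_sum_widen _ NN') [LHS]/box_sum.
rewrite (bigID (fun b : {ffun 'I_d -> 'I_N'.+1} => [forall i, b i <= N]%N)) /=.
rewrite [X in _ + X]big1 ?addr0// => b bN; apply: f0.
apply: contra bN => /forallP bN; apply/forallP => i.
by have := bN i; rewrite ffunE.
Qed.

End BoxSum.

(** * Power series along lines *)

(** Cauchy's majorant relation. Products preserve it, so majorants can be built factor by factor. *)
Definition coef_major (R : realType) (p q : {poly R}) :=
  forall k, `|p`_k| <= q`_k.

Lemma coef_major1 (R : realType) : coef_major (1 : {poly R}) 1.
Proof. by move=> k; rewrite coef1; case: eqP => _; rewrite ?normr1 ?normr0. Qed.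

Lemma coef_majorM (R : realType) (p q p' q' : {poly R}) :
  coef_major p q -> coef_major p' q' -> coef_major (p * p') (q * q').
Proof.
move=> pq pq' k; rewrite !coefM; apply: le_trans (ler_norm_sum _ _ _) _.
by apply: ler_sum => i _; rewrite normrM ler_pM.
Qed.

Lemma coef_majorX (R : realType) (p q : {poly R}) n :
  coef_major p q -> coef_major (p ^+ n) (q ^+ n).
Proof.
move=> pq; elim: n => [|n IH]; first by rewrite !expr0; exact: coef_major1.
by rewrite !exprS; exact: coef_majorM.
Qed.

(** A majorant has nonnegative coefficients, so truncating it only lowers its value at [tau]. *)
Lemma coef_major_sum_le (R : realType) (p q : {poly R}) (tau : R) n :
  coef_major p q -> 0 <= tau -> \sum_(k < n) `|p`_k| * tau ^+ k <= q.[tau].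
Proof.
move=> pq tau0; rewrite (horner_coef_wide _ (leq_addl n (size q))).
rewrite big_split_ord /=.
have q0 k : 0 <= q`_k by apply: le_trans (pq k).
apply: ler_wpDr; first by apply: sumr_ge0 => k _; rewrite mulr_ge0 ?exprn_ge0.
by apply: ler_sum => k _; rewrite ler_wpM2r ?exprn_ge0.
Qed.

Definition line_poly (R : realType) (d : nat) (y h : 'cV[R]_d)
  (mu : {ffun 'I_d -> nat}) : {poly R} :=
  \prod_(i < d) ((y i 0)%:P + h i 0 *: 'X) ^+ mu i.

Section LinePoly.
Variables (R : realType) (d : nat).
Implicit Types (y h : 'cV[R]_d) (mu : {ffun 'I_d -> nat}).

Lemma horner_line_poly y h mu t :
  (line_poly y h mu).[t] = monom mu (y + t *: h).
Proof.
rewrite horner_prod /monom; apply: eq_bigr => i _.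
by rewrite horner_exp !hornerE !mxE mulrC.
Qed.

Lemma size_line_poly y h mu : (size (line_poly y h mu) <= (\sum_i mu i).+1)%N.
Proof.
rewrite /line_poly.
elim/big_ind2: _ => [|p m p' m' pm pm'|i _]; first by rewrite size_poly1.
  apply: leq_trans (size_polyMleq _ _) _.
  by move: pm pm'; lia.
apply: leq_trans (size_poly_exp_leq _ _) _; rewrite ltnS.
have : (size ((y i 0)%:P + h i 0 *: 'X)%R <= 2)%N.
  apply: leq_trans (size_polyD _ _) _; rewrite geq_max size_polyC.
  by rewrite (leq_trans (size_scale_leq _ _)) ?size_polyX//; case: (_ != 0).
by case: (size _) => [|[|[|//]]] _; lia.
Qed.

Lemma coef_major_line_poly y h mu :
  coef_major (line_poly y h mu)
    (line_poly (map_mx Num.norm y) (map_mx Num.norm h) mu).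
Proof.
rewrite /line_poly; elim/big_ind2: _ => [|p q p' q'|i _].
- exact: coef_major1.
- exact: coef_majorM.
- apply: coef_majorX => k; rewrite !mxE !coefD !coefC !coefZ !coefX.
  case: k => [|[|k]] /=; rewrite ?mulr0 ?mulr1 ?addr0 ?add0r//.
  by rewrite normr0.
Qed.

(** The majorant takes at [tau] the value of the monomial at the vector of entries
    [|y_i| + tau |h_i|], each at most [rho]. *)
Lemma line_poly_sum_le y h mu (tau rho : R) n : 0 <= tau ->
  (forall i, `|y i 0| + tau * `|h i 0| <= rho) ->
  \sum_(k < n) `|(line_poly y h mu)`_k| * tau ^+ k <= `|monom mu (const_mx rho)|.
Proof.
move=> tau0 yh.
apply: le_trans (coef_major_sum_le _ (coef_major_line_poly y h mu) tau0) _.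
rewrite horner_line_poly /monom normr_prod; apply: ler_prod => i _.
rewrite !mxE normrX; apply/andP; split.
  by rewrite exprn_ge0// addr_ge0// mulr_ge0.
have yh0 : 0 <= `|y i 0| + tau * `|h i 0| by rewrite addr_ge0// mulr_ge0.
by apply: lerXn2r; rewrite ?nnegrE// (le_trans (yh i))// ler_norm.
Qed.

(** On a line through the origin a monomial contributes to a single power of [t]; this is why
    derivatives at [0] are homogeneous in [h]. *)
Lemma line_poly0 h mu : line_poly 0 h mu = monom mu h *: 'X^(\sum_i mu i).
Proof.
rewrite /line_poly /monom.
transitivity (\prod_(i < d) ((h i 0 ^+ mu i) *: ('X^(mu i) : {poly R}))).
  by apply: eq_bigr => i _; rewrite mxE polyC0 add0r exprZn.
by rewrite scaler_prod; congr (_ *: _); rewrite -expr_sum.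
Qed.

End LinePoly.

Lemma line_poly_truncE (R : realType) (d : nat) (y h : 'cV[R]_d)
  (mu : {ffun 'I_d -> nat}) t n :
  (\sum_i mu i < n)%N ->
  \sum_(k < n) (line_poly y h mu)`_k * t ^+ k = monom mu (y + t *: h).
Proof.
move=> mun; rewrite -horner_line_poly (@horner_coef_wide _ n)//.
exact: leq_trans (size_line_poly _ _ _) _.
Qed.

Section AnalyticLine.
Variables (R : realType) (d : nat) (F : 'cV[R]_d -> R) (x0 : 'cV[R]_d).
Variables (a : {ffun 'I_d -> nat} -> R) (r rho : R).
Hypothesis aF : forall x : 'cV[R]_d, (forall i, `|x i 0 - x0 i 0| < r) ->
  cvgn (psum_abs a x0 x) /\ (psum a x0 x @ \oo --> F x).
Hypotheses (rho0 : 0 <= rho) (rhor : rho < r).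

(** Terms of the absolute series at the corner [x0 + (rho, ..., rho)], inside the domain of
    convergence since [rho < r]. They dominate every series of this section. *)
Let G mu := `|a mu| * `|monom mu (const_mx rho : 'cV[R]_d)|.

Let psum_absE : psum_abs a x0 (x0 + const_mx rho) = box_sum G.
Proof. by apply/funext => N; rewrite /psum_abs addrAC subrr add0r. Qed.

Let cvgG : cvgn (box_sum G).
Proof.
rewrite -psum_absE; apply: (proj1 (aF _)) => i.
by rewrite !mxE addrAC subrr add0r ger0_norm.
Qed.

Variables (y h : 'cV[R]_d) (tau : R).
Hypotheses (tau0 : 0 < tau) (yh : forall i, `|y i 0| + tau * `|h i 0| <= rho).

(** The coefficient of [t ^+ k] once the series at [x0 + y + t h] is regrouped by powers of [t]. *)
Definition line_coef k :=
  limn (box_sum (fun mu => a mu * (line_poly y h mu)`_k)).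

Let coef_le mu k : `|a mu * (line_poly y h mu)`_k| <= G mu * tau ^- k.
Proof.
rewrite ler_pdivlMr ?exprn_gt0// normrM -mulrA ler_wpM2l//.
(* The term of index [k] is the last one of the sum of [k.+1] nonnegative terms. *)
apply: le_trans (line_poly_sum_le mu k.+1 (ltW tau0) yh).
rewrite big_ord_recr /= lerDr; apply: sumr_ge0 => j _.
by rewrite mulr_ge0// exprn_ge0// ltW.
Qed.

Let box_sumZ (c : R) (u : {ffun 'I_d -> nat} -> R) :
  box_sum (fun mu => u mu * c) = fun N => box_sum u N * c.
Proof. by apply/funext => N; rewrite /box_sum mulr_suml. Qed.

Let cvg_coef k :
  cvgn (box_sum (fun mu => a mu * (line_poly y h mu)`_k)).
Proof.
apply: cvg_box_sum_dominated (coef_le^~ k) _.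
by rewrite box_sumZ; apply: is_cvgMr_tmp.
Qed.

(** A Cauchy estimate whose right-hand side depends on neither [y] nor [h]; this uniformity later
    gives local boundedness. *)
Lemma line_coef_le k :
  `|line_coef k| * tau ^+ k <= limn (psum_abs a x0 (x0 + const_mx rho)).
Proof.
rewrite psum_absE -ler_pdivlMr ?exprn_gt0//.
apply: le_trans (ler_norm_box_sum_lim (coef_le^~ k) _) _.
  by rewrite box_sumZ; apply: is_cvgMr_tmp.
rewrite box_sumZ le_eqVlt; apply/orP; left; apply/eqP.
by apply: cvg_lim => //; exact: cvgMr_tmp.
Qed.

Lemma line_coef_cvg t : `|t| <= tau ->
  pseries line_coef t @ \oo --> F (x0 + y + t *: h).
Proof.
move=> ttau.
(* [u n] cuts each line polynomial after [n] powers of [t], [v] keeps it whole. Summing [u n] over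
   [mu] gives the [n]-th partial sum of the power series; both families are dominated by [G]. *)
pose u n mu := a mu * \sum_(k < n) (line_poly y h mu)`_k * t ^+ k.
pose v mu := a mu * monom mu (y + t *: h).
have uG n mu : `|u n mu| <= G mu.
  rewrite normrM ler_wpM2l//.
  apply: le_trans (line_poly_sum_le mu n (ltW tau0) yh).
  apply: le_trans (ler_norm_sum _ _ _) _; apply: ler_sum => k _.
  by rewrite normrM normrX ler_wpM2l// lerXn2r// nnegrE// ltW.
have uv n (mu : {ffun 'I_d -> nat}) : (\sum_i mu i < n)%N -> u n mu = v mu.
  by move=> mun; rewrite /u line_poly_truncE.
have vG mu : `|v mu| <= G mu by rewrite -(uv _.+1 mu (leqnn _)).
have limv : limn (box_sum v) = F (x0 + y + t *: h).
  have [i|_] := aF (x := x0 + y + t *: h).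
    rewrite !mxE [X in `|X|](_ : _ = y i 0 + t * h i 0); last by ring.
    apply: le_lt_trans rhor; apply: le_trans (yh i).
    by rewrite (le_trans (ler_normD _ _))// lerD2l normrM ler_wpM2r.
  have -> : psum a x0 (x0 + y + t *: h) = box_sum v.
    apply/funext => N; rewrite /psum /box_sum /v.
    have -> : x0 + y + t *: h - x0 = y + t *: h by rewrite addrAC (addrC x0) addrK.
    by [].
  exact: cvg_lim.
have limu n : limn (box_sum (u n)) = pseries line_coef t n.
  apply: cvg_lim => //.
  rewrite (_ : box_sum (u n) = fun N => \sum_(k < n)
      box_sum (fun mu => a mu * (line_poly y h mu)`_k) N * t ^+ k); last first.
    apply/funext => N; rewrite /box_sum /u.
    under eq_bigr do rewrite mulr_sumr.
    rewrite exchange_big; apply: eq_bigr => k _; rewrite mulr_suml.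
    by apply: eq_bigr => b _; rewrite mulrA.
  rewrite /pseries /series /= big_mkord.
  apply: cvg_big => [|k _]; first exact: add_continuous.
  by apply: cvgMr_tmp; exact: cvg_coef.
rewrite -limv; apply/cvgrPdist_le => e e0.
have /cvgrPdist_le/(_ (e / 2)) : box_sum G @ \oo --> limn (box_sum G) by [].
rewrite divr_gt0// => /(_ isT)[N _ /(_ N (leqnn N))]; rewrite /= => GN.
(* Indices in the cube of side [N] have weight at most [d * N], so there [u n] and [v] agree; the
   two tails outside the cube cost [e / 2] each. *)
exists (d * N).+1 => // n /= dNn.
rewrite -limu.
have eqN : box_sum (u n) N = box_sum v N.
  apply: eq_bigr => b _; apply: uv; apply: leq_ltn_trans dNn.
  rewrite -[X in (X * N)%N](card_ord d) -sum_nat_const leq_sum// => i _.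
  by rewrite ffunE -ltnS.
have := ler_norm_box_sum_tail N (uG n) cvgG.
have := ler_norm_box_sum_tail N vG cvgG.
rewrite eqN => h1 h2.
move: GN; rewrite ger0_norm; last first.
  by rewrite subr_ge0; apply: ler_box_sum_lim => // mu; rewrite mulr_ge0.
move=> GN; rewrite -(subrKA (box_sum v N)) (le_trans (ler_normD _ _))//.
by rewrite [X in _ + X]distrC; lra.
Qed.

End AnalyticLine.

(** * Derivatives of power series *)

(** A radius of convergence of at least [tau]. Bounds are asked only at smaller radii, so that
    differentiation preserves the property. *)
Definition geom_bounded (R : realType) (tau : R) (c : nat -> R) :=
  forall tau', 0 < tau' < tau -> exists M, forall k, `|c k| * tau' ^+ k <= M.

Section PowerSeries.
Variables (R : realType) (tau : R).
Implicit Types c : nat -> R.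

(** Bernoulli's inequality for the ratio [s' / s]; it absorbs the factor [k] created by
    differentiation into a larger radius. *)
Lemma natr_exp_le (s s' : R) k : 0 < s < s' ->
  k%:R * (s' / s - 1) * s ^+ k <= s' ^+ k.
Proof.
move=> /andP[s0 ss'].
rewrite -ler_pdivlMr ?exprn_gt0// -expr_div_n; set u := s' / s.
have u1 : 1 <= u by rewrite ler_pdivlMr// mul1r ltW.
elim: k => [|k IH]; first by rewrite mul0r expr0 ler01.
rewrite exprS -addn1 natrD mulrDl mul1r.
have : 1 <= u ^+ k by rewrite exprn_ege1.
move: IH; move: (u ^+ k) => v; nra.
Qed.

Lemma geom_bounded_diffs c :
  geom_bounded tau c -> geom_bounded tau (pseries_diffs c).
Proof.
move=> bc s /andP[s0 st].
have [M cM] : exists M, forall k, `|c k| * ((s + tau) / 2) ^+ k <= M.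
  by apply: bc; apply/andP; split; lra.
move: cM; set s' := (s + tau) / 2 => cM.
have ss' : 0 < s < s' by apply/andP; split => //; rewrite /s'; lra.
have D0 : 0 < s' / s - 1 by rewrite subr_gt0 ltr_pdivlMr// mul1r; case/andP: ss'.
(* The factor [s] accounts for the index shift in [pseries_diffs], the other one comes from
   [natr_exp_le]. *)
exists (M / (s * (s' / s - 1))) => k.
rewrite ler_pdivlMr ?mulr_gt0// /pseries_diffs normrM normr_nat.
apply: le_trans (cM k.+1).
have := natr_exp_le k.+1 ss'; move: (s' / s - 1) D0 => D D0 H.
rewrite [X in X <= _](_ : _ = `|c k.+1| * (k.+1%:R * D * s ^+ k.+1)).
  by rewrite ler_wpM2l.
by rewrite exprS; ring.
Qed.

Lemma geom_bounded_cvg c t : geom_bounded tau c -> `|t| < tau ->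
  cvgn (pseries c t).
Proof.
move=> bc tt; pose s := (`|t| + tau) / 2.
have nt0 := normr_ge0 t.
have s0 : 0 < s by rewrite /s; lra.
have [|M cM] := bc s; first by apply/andP; split => //; rewrite /s; lra.
have M0 : 0 <= M by apply: le_trans (cM 0%N); rewrite mulr_ge0// exprn_ge0// ltW.
apply: normed_cvg; apply: (@series_le_cvg _ _ (geometric M (`|t| / s))).
- by move=> k; exact: normr_ge0.
- by move=> k; rewrite /= mulr_ge0// exprn_ge0// divr_ge0// ltW.
- move=> k; rewrite /= normrM normrX expr_div_n mulrA ler_pdivlMr ?exprn_gt0//.
  by rewrite mulrAC ler_wpM2r// exprn_ge0.
apply: is_cvg_geometric_series.
rewrite ger0_norm; last by rewrite divr_ge0// ltW.
by rewrite ltr_pdivrMr// mul1r /s; lra.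
Qed.

Lemma geom_bounded_is_derive c (t : R) : geom_bounded tau c -> `|t| < tau ->
  is_derive t 1 (fun s => limn (pseries c s)) (limn (pseries (pseries_diffs c) t)).
Proof.
move=> bc tt; have nt0 := normr_ge0 t.
have bc1 := geom_bounded_diffs bc; have bc2 := geom_bounded_diffs bc1.
have K0 : `|(`|t| + tau) / 2| = (`|t| + tau) / 2 by rewrite ger0_norm//; lra.
(* The series and its first two formal derivatives must converge at a point of modulus above [|t|];
   the midpoint of [|t|] and [tau] serves. *)
apply: (@pseries_snd_diffs _ _ ((`|t| + tau) / 2)).
- by apply: geom_bounded_cvg => //; rewrite K0; lra.
- by apply: geom_bounded_cvg => //; rewrite K0; lra.
- by apply: geom_bounded_cvg => //; rewrite K0; lra.
- by rewrite K0; lra.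
Qed.

Lemma geom_bounded_iter_diffs c k :
  geom_bounded tau c -> geom_bounded tau (iter k (@pseries_diffs R) c).
Proof. by move=> bc; elim: k => //= k; exact: geom_bounded_diffs. Qed.

Lemma lim_pseries0 c : limn (pseries c 0) = c 0%N.
Proof.
apply: cvg_lim => //; apply: cvg_near_cst; exists 1%N => // -[//|n] _.
rewrite /pseries /series /= big_nat_recl//= expr0 mulr1 big1 ?addr0// => i _.
by rewrite expr0n mulr0.
Qed.

(** Stated without division; [i = 0] gives the factor [k!] between derivatives and coefficients. *)
Lemma iter_pseries_diffs c k i :
  i`!%:R * iter k (@pseries_diffs R) c i = (i + k)`!%:R * c (i + k)%N.
Proof.
elim: k i => [|k IH] i /=; first by rewrite addn0.
rewrite addnS -addSn -IH /pseries_diffs factS natrM; ring.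
Qed.

End PowerSeries.

(** * Iterated directional derivatives along a line *)

Section DerivativeAlongLine.
Variables (R : realType) (d : nat).
Implicit Types (F G : 'cV[R]_d -> R) (x h : 'cV[R]_d).

(** The two difference quotients are the same function, so derivatives transfer between the line and
    the space without any assumption across the line. *)
Lemma growth_rate_line G x h (t : R) :
  (fun s : R => s^-1 *: ((G \o shift (x + t *: h)) (s *: h) - G (x + t *: h))) =
  (fun s : R => s^-1 *: (((fun u : R => G (x + u *: h)) \o shift t) (s *: 1) -
     G (x + t *: h))).
Proof.
apply/funext => s /=; congr (_ *: (G _ - _)).
by rewrite scalerDl -[s *: 1]/(s * 1) mulr1 addrCA.
Qed.

Lemma is_derive_line G x h (t l : R) :
  is_derive t 1 (fun s : R => G (x + s *: h)) l ->
  is_derive (x + t *: h) h G l.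
Proof.
case=> dG <-; apply: DeriveDef.
  by move: dG; rewrite /derivable growth_rate_line.
by rewrite /derive growth_rate_line.
Qed.

Lemma is_derive_line1 G x h (t l : R) :
  is_derive (x + t *: h) h G l ->
  is_derive t 1 (fun s : R => G (x + s *: h)) l.
Proof.
case=> dG <-; apply: DeriveDef.
  by move: dG; rewrite /derivable growth_rate_line.
by rewrite /derive growth_rate_line.
Qed.

Lemma is_derive_Dk_line F x h (tau : R) c : geom_bounded tau c ->
  (forall t : R, `|t| < tau -> F (x + t *: h) = limn (pseries c t)) ->
  forall k (t : R), `|t| < tau ->
  Dk k F (x + t *: h) h = limn (pseries (iter k (@pseries_diffs R) c) t) /\
  derivable (fun z => Dk k F z h) (x + t *: h) h.
Proof.
move=> bc Fc k.
(* Differentiating at [t] requires the formula of order [j] on a neighbourhood of [t], hence its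
   quantification over the whole interval. *)
have der j : (forall t : R, `|t| < tau ->
    Dk j F (x + t *: h) h = limn (pseries (iter j (@pseries_diffs R) c) t)) ->
  forall t : R, `|t| < tau -> is_derive (x + t *: h) h (fun z => Dk j F z h)
    (limn (pseries (iter j.+1 (@pseries_diffs R) c) t)).
  move=> Dj t tt; apply: is_derive_line.
  apply: near_eq_is_derive; last first.
    exact: (geom_bounded_is_derive (geom_bounded_iter_diffs j bc) tt).
  have : \forall s \near t, `|s| < tau.
    by apply: (@cvgr_lt R R (nbhs t) _ Num.norm `|t|) => //; apply: cvg_norm.
  by apply: filterS => s st; rewrite Dj.
have Dj : forall j (t : R), `|t| < tau ->
    Dk j F (x + t *: h) h = limn (pseries (iter j (@pseries_diffs R) c) t).
  elim=> [//|j IH] t tt; rewrite -(@derive_val _ _ _ _ _ _ _ (der j IH t tt)).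
  by [].
by move=> t tt; split; [exact: Dj | have [] := der k (Dj k) t tt].
Qed.

Lemma Dk_line0 F x h (tau : R) c : 0 < tau -> geom_bounded tau c ->
  (forall t : R, `|t| < tau -> F (x + t *: h) = limn (pseries c t)) ->
  forall k, Dk k F x h = k`!%:R * c k /\ derivable (fun z => Dk k F z h) x h.
Proof.
move=> tau0 bc Fc k.
have [|] := @is_derive_Dk_line F x h tau c bc Fc k 0; first by rewrite normr0.
rewrite scale0r addr0 lim_pseries0 => -> dk; split => //.
by rewrite -(add0n k) -iter_pseries_diffs mul1r.
Qed.

End DerivativeAlongLine.

(** * Functions with tame directional derivatives *)

(** A list of coefficients and exponents, repetitions allowed: sums become concatenations and
    products become lists of pairwise products. *)
Definition hom_poly (R : realType) (d j : nat) (p : 'cV[R]_d -> R) :=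
  exists s : seq (R * {ffun 'I_d -> nat}),
    (forall t, t \in s -> (\sum_i t.2 i)%N = j) /\
    forall h, p h = \sum_(t <- s) t.1 * monom t.2 h.

Definition locally_bounded (R : realType) (d : nat)
  (G : 'cV[R]_d -> 'cV[R]_d -> R) :=
  forall x0 : 'cV[R]_d, exists delta : R, 0 < delta /\ exists B : R,
    forall x h : 'cV[R]_d, (forall i, `|x i 0 - x0 i 0| < delta) ->
      (forall i, `|h i 0| <= 1) -> `|G x h| <= B.

(* [G x h] stands for a quantity of degree [j] in the direction [h]; each
   derivative is taken along the same direction [h], raising the degree. *)
Fixpoint tame (R : realType) (d n j : nat) (G : 'cV[R]_d -> 'cV[R]_d -> R)
    : Prop :=
  [/\ locally_bounded G, hom_poly j (G 0)
    & if n is n'.+1 then (forall x h, derivable (G^~ h) x h) /\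
        tame n' j.+1 (fun x h => 'D_h (G^~ h) x)
      else True].

Section Tame.
Variables (R : realType) (d : nat).
Implicit Types (p : 'cV[R]_d -> R) (G H : 'cV[R]_d -> 'cV[R]_d -> R).

Lemma monomD (mu nu : {ffun 'I_d -> nat}) (x : 'cV[R]_d) :
  monom [ffun i => (mu i + nu i)%N] x = monom mu x * monom nu x.
Proof.
by rewrite /monom -big_split; apply: eq_bigr => i _; rewrite ffunE exprD.
Qed.

Lemma hom_polyC (c : R) : hom_poly 0 (fun _ : 'cV[R]_d => c).
Proof.
exists [:: (c, [ffun => 0%N])]; split=> [t|h].
  by rewrite inE => /eqP -> /=; rewrite big1// => i _; rewrite ffunE.
by rewrite big_seq1 /monom big1 ?mulr1// => i _; rewrite ffunE expr0.
Qed.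

Lemma hom_poly0 j : hom_poly j (fun _ : 'cV[R]_d => 0 : R).
Proof. by exists [::]; split=> // h; rewrite big_nil. Qed.

Lemma hom_polyD j p p' :
  hom_poly j p -> hom_poly j p' -> hom_poly j (fun h => p h + p' h).
Proof.
move=> [s [sj ps]] [s' [s'j ps']]; exists (s ++ s'); split=> [t|h].
  by rewrite mem_cat => /orP[/sj|/s'j].
by rewrite big_cat ps ps'.
Qed.

Lemma hom_polyM j j' p p' :
  hom_poly j p -> hom_poly j' p' -> hom_poly (j + j') (fun h => p h * p' h).
Proof.
move=> [s [sj ps]] [s' [s'j ps']].
pose mul (t t' : R * {ffun 'I_d -> nat}) : R * {ffun 'I_d -> nat} :=
  (t.1 * t'.1, [ffun i => (t.2 i + t'.2 i)%N]).
exists [seq mul t t' | t <- s, t' <- s'].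
split=> [_ /allpairsP[[t t'] /= [/sj <- /s'j <- ->]] /=|h].
  by rewrite -big_split; apply: eq_bigr => i _; rewrite ffunE.
rewrite big_allpairs_dep ps ps' mulr_suml; apply: eq_bigr => t _.
rewrite mulr_sumr; apply: eq_bigr => t' _ /=.
by rewrite monomD mulrACA.
Qed.

Lemma locally_boundedD G H : locally_bounded G -> locally_bounded H ->
  locally_bounded (fun x h => G x h + H x h).
Proof.
move=> bG bH x0; have [r [r0 [B GB]]] := bG x0; have [s [s0 [C HC]]] := bH x0.
exists (Num.min r s); split; first by rewrite lt_min r0.
exists (B + C) => x h xx hh; apply: le_trans (ler_normD _ _) (lerD _ _).
  by apply: GB => // i; have := xx i; rewrite lt_min => /andP[].
by apply: HC => // i; have := xx i; rewrite lt_min => /andP[].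
Qed.

Lemma locally_boundedM G H : locally_bounded G -> locally_bounded H ->
  locally_bounded (fun x h => G x h * H x h).
Proof.
move=> bG bH x0; have [r [r0 [B GB]]] := bG x0; have [s [s0 [C HC]]] := bH x0.
exists (Num.min r s); split; first by rewrite lt_min r0.
exists (B * C) => x h xx hh; rewrite normrM; apply: ler_pM => //.
  by apply: GB => // i; have := xx i; rewrite lt_min => /andP[].
by apply: HC => // i; have := xx i; rewrite lt_min => /andP[].
Qed.

Lemma locally_boundedC (c : R) : locally_bounded (fun _ _ : 'cV[R]_d => c).
Proof. by move=> x0; exists 1; split=> //; exists `|c|. Qed.

Lemma eq_tame n j G H : (forall x h, G x h = H x h) -> tame n j G -> tame n j H.
Proof.
move=> GH; suff -> : G = H by [].
by apply/funext => x; apply/funext => h.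
Qed.

(** Serves the product rule, where one factor of each term remains undifferentiated. *)
Lemma tameW n j G : tame n.+1 j G -> tame n j G.
Proof.
elim: n j G => [|n IH] j G [bG hG [dG tG]]; split=> //; split=> //.
exact: IH.
Qed.

Lemma tame0 n j : tame n j (fun _ _ : 'cV[R]_d => 0 : R).
Proof.
elim: n j => [|n IH] j; split=> //; [exact: locally_boundedC|exact: hom_poly0|
  exact: locally_boundedC|exact: hom_poly0|split].
  by move=> x h; exact: derivable_cst.
by apply: eq_tame (IH _) => x h; rewrite derive_cst.
Qed.

Lemma tameC n (c : R) : tame n 0 (fun _ _ : 'cV[R]_d => c).
Proof.
case: n => [|n]; split=> //; [exact: locally_boundedC|exact: hom_polyC|
  exact: locally_boundedC|exact: hom_polyC|split].
  by move=> x h; exact: derivable_cst.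
by apply: eq_tame (tame0 _ _) => x h; rewrite derive_cst.
Qed.

Lemma tameD n j G H :
  tame n j G -> tame n j H -> tame n j (fun x h => G x h + H x h).
Proof.
elim: n j G H => [|n IH] j G H [bG hG tG] [bH hH tH].
  by split=> //; [exact: locally_boundedD|exact: hom_polyD].
have [dG {}tG] := tG; have [dH {}tH] := tH.
split; [exact: locally_boundedD|exact: hom_polyD|split].
  by move=> x h; exact: derivableD.
by apply: eq_tame (IH _ _ _ tG tH) => x h; rewrite -deriveD.
Qed.

(** In both terms of the product rule exactly one factor gains a degree, and both factors are tame
    of the smaller order. *)
Lemma tameM n j j' G H :
  tame n j G -> tame n j' H -> tame n (j + j') (fun x h => G x h * H x h).
Proof.
elim: n j j' G H => [|n IH] j j' G H tG tH.
  case: tG tH => [bG hG _] [bH hH _].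
  by split=> //; [exact: locally_boundedM|exact: hom_polyM].
have wG := tameW tG; have wH := tameW tH.
case: tG tH => [bG hG [dG tG]] [bH hH [dH tH]].
split; [exact: locally_boundedM|exact: hom_polyM|split].
  by move=> x h; exact: derivableM.
have tGH : tame n (j + j').+1
    (fun x h => G x h * 'D_h (H^~ h) x + 'D_h (G^~ h) x * H x h).
  by apply: tameD; [rewrite -addnS|rewrite -addSn]; exact: IH.
apply: eq_tame tGH => x h; rewrite [X in _ + X]mulrC; symmetry.
exact: deriveM.
Qed.

Lemma tame_prod n (I : Type) (s : seq I) (G : I -> 'cV[R]_d -> 'cV[R]_d -> R) :
  (forall i, tame n 0 (G i)) -> tame n 0 (fun x h => \prod_(i <- s) G i x h).
Proof.
move=> tG; elim: s => [|i s IH].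
  by apply: eq_tame (tameC n 1) => x h; rewrite big_nil.
by apply: eq_tame (tameM (tG i) IH) => x h; rewrite big_cons.
Qed.

Lemma tameX n k G : tame n 0 G -> tame n 0 (fun x h => G x h ^+ k).
Proof.
move=> tG; apply: eq_tame (tame_prod (iota 0 k) (fun=> tG)) => x h.
by rewrite big_const_seq count_predT size_iota -Monoid.iteropE.
Qed.

(** Differentiating [Dk j F] along [h] gives [Dk j.+1 F] by conversion, so the three hypotheses fill
    every level of [tame]. *)
Lemma tame_Dk n (F : 'cV[R]_d -> R) :
  (forall k x h, derivable (fun z => Dk k F z h) x h) ->
  (forall k, locally_bounded (Dk k F)) ->
  (forall k, hom_poly k (Dk k F 0)) -> tame n 0 (fun x _ => F x).
Proof.
move=> dF bF hF.
suff tj : forall n j, tame n j (Dk j F) by have := tj n 0%N.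
by elim=> [|m IH] j; split=> //; split=> //; exact: IH j.+1.
Qed.

Lemma tame_Dk_inv n (F : 'cV[R]_d -> R) : tame n 0 (fun x _ => F x) ->
  forall k, (k <= n)%N -> tame (n - k) k (Dk k F).
Proof.
move=> tF; elim=> [|k IH] kn; first by rewrite subn0.
have := IH (ltnW kn); rewrite -subSS subSn//.
by case=> _ _ [_]; exact.
Qed.

End Tame.

(** * Tameness of analytic functions and bounds on compact cubes *)

Section AnalyticDerivatives.
Variables (R : realType) (d : nat).
Implicit Types (F : 'cV[R]_d -> R) (x y h : 'cV[R]_d).

(** The order of quantifiers matters: [a], [rho] and [M] are fixed by [x0] before the displacement
    [y], the direction [h] and the step [tau] are chosen. *)
Lemma analytic_at_Dk F x0 : analytic_at F x0 ->
  exists a : {ffun 'I_d -> nat} -> R, exists rho M : R, 0 < rho /\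
  forall y h tau, 0 < tau -> (forall i, `|y i 0| + tau * `|h i 0| <= rho) ->
  forall k, [/\ Dk k F (x0 + y) h = k`!%:R * line_coef a y h k,
    `|line_coef a y h k| * tau ^+ k <= M
    & derivable (fun z => Dk k F z h) (x0 + y) h].
Proof.
move=> [a [r [r0 aF]]]; exists a, (r / 2).
exists (limn (psum_abs a x0 (x0 + const_mx (r / 2)))).
split=> [|y h tau tau0 yh k]; first by lra.
have rho0 : 0 <= r / 2 by lra.
have rhor : r / 2 < r by lra.
have cM := line_coef_le aF rho0 rhor tau0 yh.
have cF := line_coef_cvg aF rho0 rhor tau0 yh.
have bc : geom_bounded tau (line_coef a y h).
  move=> s /andP[s0 st]; eexists => j; apply: le_trans (cM j).
  by rewrite ler_wpM2l// lerXn2r ?nnegrE// ltW.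
have [|-> dk] := @Dk_line0 R d F (x0 + y) h tau _ tau0 bc _ k.
  by move=> t /ltW/cF cFt; apply/esym/cvg_lim.
by split.
Qed.

Lemma exists_small_step h (rho : R) : 0 < rho ->
  exists tau, 0 < tau /\ forall i, tau * `|h i 0| <= rho.
Proof.
move=> rho0; pose S := \sum_i `|h i 0|.
have S0 : 0 <= S by exact: sumr_ge0.
(* The summand [1] keeps the denominator positive when [h] is zero. *)
exists (rho / (1 + S)); split=> [|i]; first by rewrite divr_gt0//; lra.
rewrite mulrAC ler_pdivrMr; last by lra.
rewrite ler_pM2l// /S (bigD1 i)//=.
have : 0 <= \sum_(j < d | j != i) `|h j 0| by exact: sumr_ge0.
lra.
Qed.

Lemma analytic_derivable_Dk F : (forall x, analytic_at F x) ->
  forall k x h, derivable (fun z => Dk k F z h) x h.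
Proof.
move=> aF k x h; have [a [rho [M [rho0 H]]]] := analytic_at_Dk (aF x).
have [tau [tau0 tauh]] := exists_small_step h rho0.
have [|_ _] := H 0 h tau tau0 _ k; last by rewrite addr0.
by move=> i; rewrite mxE normr0 add0r.
Qed.

Lemma analytic_locally_bounded_Dk F : (forall x, analytic_at F x) ->
  forall k, locally_bounded (Dk k F).
Proof.
move=> aF k x0; have [a [rho [M [rho0 H]]]] := analytic_at_Dk (aF x0).
(* Half of [rho] is spent on the displacement of the base point, half on the step along [h]. *)
exists (rho / 2); split; first by lra.
exists (k`!%:R * (M / (rho / 2) ^+ k)) => x h xx hh.
have [||] := H (x - x0) h (rho / 2) _ _ k; first by lra.
  move=> i; rewrite !mxE; have := ltW (xx i); have := hh i; nra.
rewrite addrC subrK => -> cM _; rewrite normrM normr_nat ler_wpM2l//.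
by rewrite ler_pdivlMr// exprn_gt0//; lra.
Qed.

(** By [line_poly0] only indices of weight [k] contribute. They all lie in the cube of side [k], so
    the box sums are constant from there on. *)
Lemma line_coef0 (a : {ffun 'I_d -> nat} -> R) h k : line_coef a 0 h k =
  \sum_(b : {ffun 'I_d -> 'I_k.+1} | (\sum_i box_mi b i)%N == k)
    a (box_mi b) * monom (box_mi b) h.
Proof.
pose f mu := a mu * (line_poly 0 h mu)`_k.
have fE (mu : {ffun 'I_d -> nat}) :
    f mu = if (\sum_i mu i)%N == k then a mu * monom mu h else 0.
  rewrite /f line_poly0 coefZ coefXn eq_sym.
  by case: eqP => _; rewrite ?mulr1 ?mulr0.
transitivity (box_sum f k); last first.
  by rewrite [RHS]big_mkcond; apply: eq_bigr => b _; rewrite fE.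
apply: cvg_lim => //; apply: cvg_near_cst; exists k => // N /= kN.
apply: box_sum_stable => // mu /forallPn[i ik].
rewrite -/(f mu) fE ifN//; apply: contra ik => /eqP <-.
by rewrite (bigD1 i)//= leq_addr.
Qed.

Lemma analytic_hom_poly_Dk F : (forall x, analytic_at F x) ->
  forall k, hom_poly k (Dk k F 0).
Proof.
move=> aF k; have [a [rho [M [rho0 H]]]] := analytic_at_Dk (aF 0).
exists [seq (k`!%:R * a (box_mi b), box_mi b) |
  b : {ffun 'I_d -> 'I_k.+1} <- [seq b : {ffun 'I_d -> 'I_k.+1} <-
    index_enum _ | (\sum_i box_mi b i)%N == k]].
split=> [_ /mapP[b + ->] /=|h].
  by rewrite mem_filter => /andP[/eqP].
rewrite big_map big_filter /=.
(* The step varies with [h] but the coefficients [a] do not, so one list of monomials serves all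
   directions. *)
have [tau [tau0 tauh]] := exists_small_step h rho0.
have [|] := H 0 h tau tau0 _ k; first by move=> i; rewrite mxE normr0 add0r.
rewrite addr0 line_coef0 => -> _ _; rewrite mulr_sumr.
by apply: eq_bigr => b _; rewrite mulrA.
Qed.

Lemma analytic_tame n F : (forall x, analytic_at F x) ->
  tame n 0 (fun x _ => F x).
Proof.
move=> aF; apply: tame_Dk.
- exact: analytic_derivable_Dk.
- exact: analytic_locally_bounded_Dk.
- exact: analytic_hom_poly_Dk.
Qed.

Lemma locally_bounded_compact (G : 'cV[R]_d -> 'cV[R]_d -> R) (c : R) :
  locally_bounded G -> exists B : R, forall x h : 'cV[R]_d,
    (forall i, `|x i 0| <= c) -> (forall i, `|h i 0| <= 1) -> `|G x h| <= B.
Proof.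
move=> bG.
have : compact [set v : 'rV[R]_d | forall i, `[- c, c]%classic (v ord0 i)].
  apply: (@rV_compact _ _ (fun=> `[- c, c]%classic)) => i.
  exact: segment_compact.
(* Compactness in covering form, with the bound tending to [+oo]: bounds that eventually work near
   each point eventually work on the whole cube. *)
move=> /compact_near_coveringP/(_ R +oo%R (fun B v => forall h : 'cV[R]_d,
  (forall i, `|h i 0| <= 1) -> `|G v^T h| <= B)) /=.
case=> [v _|B [_ HB]].
  have [delta [delta0 [B GB]]] := bG v^T.
  exists (ball v delta, [set N | B < N]).
    split; first exact: nbhsx_ballx.
    by exists B; split => //; exact: num_real.
  move=> [w N] [/= vw BN] h hh; apply: le_trans (ltW BN); apply: GB => // i.
  by rewrite !mxE distrC; have [_] := vw; exact.
exists (B + 1) => x h xc hh; rewrite -[x]trmxK.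
apply: HB => //; first by rewrite ltrDl.
by move=> i /=; rewrite mxE in_itv /= -ler_norml.
Qed.

End AnalyticDerivatives.

(** * Taylor's formula *)

Lemma is_derive_taylor_weight (R : realType) (c t : R) k :
  is_derive t 1 (fun s : R => (c - s) ^+ k.+1 / k.+1`!%:R)
    (- ((c - t) ^+ k / k`!%:R)).
Proof.
have h2 := is_deriveX k.+1 (is_deriveB (is_derive_cst c t 1) (is_derive_id t 1)).
have h3 := is_deriveZ k.+1`!%:R^-1 h2.
have -> : (fun s : R => (c - s) ^+ k.+1 / k.+1`!%:R) =
    k.+1`!%:R^-1 \*: (cst c - id) ^+ k.+1.
  by apply/funext => s; rewrite mulrC !fctE.
apply: is_derive_eq h3 _.
rewrite factS natrM /= sub0r invfM.
rewrite -[LHS]/(_ * (_ * _)) mulrN1 mulrN; congr (- _).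
by rewrite mulrACA mulVf ?pnatr_eq0// mul1r mulrC.
Qed.

(** The mean value theorem is applied to the Taylor polynomial as a function of its base point,
    compared with [B] times the next Taylor weight. *)
Lemma taylor_bound (R : realType) (phi : nat -> R -> R) (c B : R) n :
  0 < c -> (forall k (t : R), (k <= n)%N -> is_derive t 1 (phi k) (phi k.+1 t)) ->
  (forall t, 0 <= t <= c -> `|phi n.+1 t| <= B) ->
  `|phi 0%N c - \sum_(k < n.+1) phi k 0 * (c ^+ k / k`!%:R)| <=
    c ^+ n.+1 / n.+1`!%:R * B.
Proof.
move=> c0 dphi phiB.
pose w k (t : R) := (c - t) ^+ k / k`!%:R.
(* The Taylor polynomial based at [t] and evaluated at [c]. Its derivative in [t] telescopes to one
   term; it equals [phi 0 c] at [t = c] and the sum of the statement at [t = 0]. *)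
pose psi m (t : R) := \sum_(k < m.+1) phi k t * w k t.
have dpsi m (t : R) : (m <= n)%N -> is_derive t 1 (psi m) (phi m.+1 t * w m t).
  elim: m => [|m IH] mn.
    rewrite (_ : psi 0%N = phi 0%N).
      by apply: is_derive_eq (dphi _ _ mn) _; rewrite /w expr0 fact0 divr1 mulr1.
    by apply/funext => s; rewrite /psi big_ord1 /w expr0 fact0 divr1 mulr1.
  have dw : is_derive t 1 (w m.+1) (- w m t) := is_derive_taylor_weight c t m.
  have := is_deriveD (IH (ltnW mn)) (is_deriveM (dphi _ t mn) dw).
  rewrite (_ : psi m + phi m.+1 * w m.+1 = psi m.+1); last first.
    by apply/funext => s; rewrite !fctE /psi [RHS]big_ord_recr.
  move=> h; apply: is_derive_eq h _.
  by rewrite -[_ *: _]/(_ * _) -[X in _ + (_ + X)]/(_ * _); ring.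
have wc k : w k.+1 c = 0 by rewrite /w subrr expr0n mul0r.
have psic : psi n c = phi 0%N c.
  rewrite /psi big_ord_recl big1; last by move=> i _; rewrite wc mulr0.
  by rewrite addr0 /w expr0 fact0 divr1 mulr1.
have psi0 : psi n 0 = \sum_(k < n.+1) phi k 0 * (c ^+ k / k`!%:R).
  by apply: eq_bigr => k _; rewrite /w subr0.
have bound (e : R) : `|e| = 1 ->
    e * (psi n c - psi n 0) <= c ^+ n.+1 / n.+1`!%:R * B.
  (* [D] has nonpositive derivative on the segment; the signs [e = 1] and [e = -1] give the two
     halves of the absolute value. *)
  move=> e1; pose D := e \*: psi n + B \*: w n.+1.
  have dD (t : R) : is_derive t 1 D (e * (phi n.+1 t * w n t) - B * w n t).
    have := is_deriveD (is_deriveZ e (dpsi n t (leqnn n)))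
      (is_deriveZ B (is_derive_taylor_weight c t n)).
    by move=> h; apply: is_derive_eq h _; rewrite scalerN.
  have cD : {within `[0, c], continuous D}.
    apply: derivable_within_continuous => t _.
    by have [] := dD t.
  have [xi xic] := MVT c0 (fun t _ => dD t) cD.
  rewrite subr0 {1 2}/D !fctE => DE.
  have : e * psi n c + B * w n.+1 c - (e * psi n 0 + B * w n.+1 0) =
     (e * (phi n.+1 xi * w n xi) - B * w n xi) * c by exact: DE.
  rewrite wc [w n.+1 0]/w subr0 => {}DE.
  have xi0c : 0 <= xi <= c.
    by move: xic; rewrite in_itv /= => /andP[/ltW -> /ltW ->].
  have w0 : 0 <= w n xi.
    by rewrite /w divr_ge0// exprn_ge0// subr_ge0; case/andP: xi0c.
  have : (e * (phi n.+1 xi * w n xi) - B * w n xi) * c <= 0.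
    rewrite mulr_le0_ge0//; last exact: ltW.
    rewrite mulrA -mulrBl mulr_le0_ge0// subr_le0.
    apply: le_trans (ler_norm _) _; rewrite normrM e1 mul1r; exact: phiB.
  by rewrite -DE; lra.
rewrite -psic -psi0 ler_norml -lerN2 opprK.
by have := bound 1 (normr1 _); have := bound (-1) (normrN1 _); lra.
Qed.

(** * Low-rank approximation *)

(** The row index is the set of tuples counted by [card_partial_ord_partitions]. An exponent never
    exceeds the total degree, so ['I_q.+1] loses no monomial. *)
Definition monom_mx (R : realType) (d n q : nat) (Z : 'M[R]_(d, n)) :
    'M[R]_(#|[set t : d.-tuple 'I_q.+1 | (\sum_(i <- t) i <= q)%N]%SET|, n) :=
  \matrix_(a, j) monom [ffun i => nat_of_ord (tnth (enum_val a) i)] (col j Z).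

Section MonomialMatrix.
Variables (R : realType) (d n : nat) (Z : 'M[R]_(d, n)).

Lemma rank_monom_mx q : (\rank (monom_mx q Z) <= 'C(d + q, q))%N.
Proof.
apply: leq_trans (rank_leq_row _) _; rewrite card_partial_ord_partitions.
by rewrite -bin_sub ?leq_addr// addKn.
Qed.

Lemma monom_sub_monom_mx q (mu : {ffun 'I_d -> nat}) :
  (\sum_i mu i <= q)%N -> (\row_j monom mu (col j Z) <= monom_mx q Z)%MS.
Proof.
move=> muq; pose t := [tuple inord (mu i) : 'I_q.+1 | i < d].
have muE i : nat_of_ord (tnth t i) = mu i.
  rewrite tnth_mktuple inordK// ltnS (leq_trans _ muq)//.
  by rewrite (bigD1 i)//= leq_addr.
have tT : t \in [set t : d.-tuple 'I_q.+1 | (\sum_(i <- t) i <= q)%N]%SET.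
  by rewrite inE big_tuple; under eq_bigr do rewrite muE.
rewrite (_ : \row_j _ = row (enum_rank_in tT t) (monom_mx q Z)).
  exact: row_sub.
apply/rowP => j; rewrite !mxE enum_rankK_in//; congr monom.
by apply/ffunP => i; rewrite ffunE muE.
Qed.

Lemma monom_scale (mu : {ffun 'I_d -> nat}) (c : R) (x : 'cV[R]_d) :
  monom mu (c *: x) = c ^+ (\sum_i mu i) * monom mu x.
Proof.
rewrite /monom expr_sum -big_split; apply: eq_bigr => i _.
by rewrite mxE exprMn.
Qed.

(** By homogeneity the scaling contributes the factor [c ^+ i] in every column alike, leaving a
    combination of monomial rows. *)
Lemma hom_poly_sub_monom_mx q i (p : 'cV[R]_d -> R) (c : R) : (i <= q)%N ->
  hom_poly i p -> (\row_j p (c *: col j Z) <= monom_mx q Z)%MS.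
Proof.
move=> iq [s [si ps]].
rewrite (_ : \row_j _ =
  \sum_(t <- s) (t.1 * c ^+ i) *: \row_j monom t.2 (col j Z)).
  rewrite big_seq; elim/big_ind: _ => [|A B|t ts]; first exact: sub0mx.
    exact: addmx_sub.
  by apply/scalemx_sub/monom_sub_monom_mx; rewrite si.
apply/rowP => j; rewrite mxE ps summxE !big_seq; apply: eq_bigr => t ts.
by rewrite !mxE monom_scale si// mulrA.
Qed.

End MonomialMatrix.

(** A feature is a constant times a product of powers of coordinates of [f], so closure of [tame]
    under products replaces a chain rule for the composition. *)
Lemma feat_tame (R : realType) (d m q n : nat) (f : 'cV[R]_d -> 'cV[R]_m)
  (e : 'I_('C(m + q, q)) -> {ffun 'I_m -> nat}) (cf : 'I_('C(m + q, q)) -> R) k :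
  analytic f -> tame n 0 (fun z _ => feat e cf (f z) k 0).
Proof.
move=> af.
have tf i : tame n 0 (fun z (_ : 'cV[R]_d) => f z i 0).
  by apply: analytic_tame => x; exact: af.
have tp := tame_prod (index_enum 'I_m) (fun i => tameX (e k i) (tf i)).
by apply: eq_tame (tameM (tameC d n (cf k)) tp) => z h; rewrite mxE.
Qed.

Theorem theorem1 (R : realType) (d m n q : nat)
  (cz : R) (Z : 'M[R]_(d, n)) (f : 'cV[R]_d -> 'cV[R]_m)
  (e : 'I_('C(m + q, q)) -> {ffun 'I_m -> nat}) (cf : 'I_('C(m + q, q)) -> R)
  (q' : nat) :
  (0 < d)%N -> (0 < m)%N -> (0 < n)%N -> (0 < q)%N ->
  0 < cz ->
  \rank Z = minn d n ->
  (forall i j, `|Z i j| <= cz) ->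
  analytic f ->
  poly_feature_data e cf ->
  (0 < q')%N ->
  ('C(d + q', q') <= minn 'C(m + q, q) n)%N ->
  exists Phi : 'M[R]_('C(m + q, q), n),
    (\rank Phi <= 'C(d + q', q'))%N /\
    forall (k : 'I_('C(m + q, q))) (j : 'I_n),
      `|feat e cf (f (col j Z)) k 0 - Phi k j| <=
        cz ^+ q'.+1 / (q'.+1)`!%:R *
        sup (deriv_vals q'.+1 (fun z => feat e cf (f z)) cz).
Proof.
move=> _ _ _ _ cz0 _ Zcz af _ _ _.
pose g k z := feat e cf (f z) k 0.
(* Normalized to sup norm at most [1]; the segment to [z_j] is then run through for [t] from [0] to
   [cz], whence the power of [cz] in the error. *)
pose h j := cz^-1 *: col j Z.
have tg k i : (i <= q'.+2)%N -> tame (q'.+2 - i) i (Dk i (g k)).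
  exact: tame_Dk_inv (feat_tame _ _ _ _ af) _.
have dg k i x v : (i <= q')%N -> derivable (fun z => Dk i (g k) z v) x v.
  by move=> iq; have := tg k i; rewrite subSn ?leqW// => -[|_ _ []]; rewrite ?leqW.
(* [sup] has a default value on unbounded sets, so it dominates the derivative values only once they
   are known to be bounded. *)
have ub : has_ubound (deriv_vals q'.+1 (fun z => feat e cf (f z)) cz).
  have /choice[B gB] k : exists B : R, forall x v : 'cV[R]_d,
      (forall i, `|x i 0| <= cz) -> (forall i, `|v i 0| <= 1) ->
      `|Dk q'.+1 (g k) x v| <= B.
    apply: locally_bounded_compact.
    by have := tg k q'.+1 (leqnSn _); rewrite subSnn => -[].
  exists (\sum_k `|B k|) => _ [k [z [v [zc vc ->]]]].
  apply: le_trans (gB k z v zc vc) _; rewrite (bigD1 k)//=.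
  by apply: ler_wpDr; [exact: sumr_ge0|exact: ler_norm].
have h1 j a : `|h j a 0| <= 1.
  by rewrite !mxE normrM normfV (gtr0_norm cz0) mulrC ler_pdivrMr// mul1r.
(* Entry [(k, j)] is the Taylor polynomial of degree [q'] at [0] of the [k]-th feature, evaluated at
   [z_j = cz h_j]. *)
exists (\matrix_(k, j) \sum_(i < q'.+1) Dk i (g k) 0 (h j) * (cz ^+ i / i`!%:R)).
split=> [|k j].
  (* Each Taylor term is homogeneous of degree at most [q'] in [z_j], so every row lies in the row
     space of the monomial matrix. *)
  apply: leq_trans (rank_monom_mx Z q'); apply/mxrankS/row_subP => k.
  rewrite (_ : row k _ = \sum_(i < q'.+1) (cz ^+ i / i`!%:R) *:
      \row_j Dk i (g k) 0 (cz^-1 *: col j Z)).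
    apply: summx_sub => i _; apply/scalemx_sub/(@hom_poly_sub_monom_mx _ _ _ _ _ i).
      by rewrite -ltnS.
    by have := tg k i (leqW (ltnW (ltn_ord i))); case: (_ - _)%N => [|?] [].
  apply/rowP => j; rewrite !mxE summxE; apply: eq_bigr => i _.
  by rewrite !mxE mulrC.
pose phi i t := Dk i (g k) (0 + t *: h j) (h j).
have -> : feat e cf (f (col j Z)) k 0 = phi 0%N cz.
  by rewrite /phi /Dk /= add0r /h scalerA divff ?gt_eqF// scale1r.
rewrite mxE.
have -> : \sum_(i < q'.+1) Dk i (g k) 0 (h j) * (cz ^+ i / i`!%:R) =
    \sum_(i < q'.+1) phi i 0 * (cz ^+ i / i`!%:R).
  by apply: eq_bigr => i _; rewrite /phi scale0r addr0.
apply: taylor_bound => // [i t iq|t /andP[t0 tc]].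
  apply: is_derive_line1; apply: DeriveDef => //; exact: dg.
apply: ub_le_sup => //; exists k, (0 + t *: h j), (h j); split=> // a.
rewrite add0r mxE normrM ger0_norm//.
by rewrite -[leRHS]mulr1 ler_pM.
Qed.
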